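(* Let $G$ be a finite simple triangle-free graph having a perfect matching $M$. Let $h$ denote the number of connected components of the graph $G\setminus M$ (the spanning subgraph of $G$ with edge set $E(G)\setminus M$). Let $OPT$ denote the number of colours in an optimal (maximum) edge $2$-colouring of $G$. Then $$OPT\leq \frac{8}{5}\bigl(|M|+h\bigr).$$
   Context: An edge $2$-colouring of a graph $G$ is an assignment of colours to the edges of $G$ (not necessarily proper) such that, at every vertex, the edges incident with that vertex carry at most $2$ distinct colours. An optimal edge $2$-colouring is one that uses the maximum possible number of distinct colours; $OPT$ is that maximum number. *)

(* Defs.v *)
From mathcomp Require Import all_boot all_order.
Set Implicit Arguments. Unset Strict Implicit. Unset Printing Implicit Defensive.

Section Graphs.
Variable T : finType.

Definition simple_graph (e : rel T) : Prop := symmetric e /\ irreflexive e.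

Definition triangle_free (e : rel T) : Prop :=
  forall x y z : T, ~~ [&& e x y, e y z & e z x].

Definition edges (e : rel T) : {set {set T}} :=
  [set [set x; y] | x in T, y in T & e x y].

Definition perfect_matching (e : rel T) (M : {set {set T}}) : Prop :=
  M \subset edges e /\ forall v : T, #|[set f in M | v \in f]| = 1.

Definition remove_edges (e : rel T) (M : {set {set T}}) : rel T :=
  fun x y => e x y && ([set x; y] \notin M).

Definition num_components (e : rel T) : nat := n_comp e [set: T].

(* An edge colouring assigns a colour (a natural number) to each edge;
   only its values on edges matter. *)
Definition colours_at (e : rel T) (c : {set T} -> nat) (v : T) : seq nat :=
  undup [seq c f | f <- [seq f : {set T} <- enum (edges e) | v \in f]].

Definition is_edge_2colouring (e : rel T) (c : {set T} -> nat) : Prop :=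
  forall v : T, size (colours_at e c v) <= 2.

Definition num_colours (e : rel T) (c : {set T} -> nat) : nat :=
  size (undup [seq c f | f <- enum (edges e)]).

End Graphs.

(* Main.v *)
(** For a colour [k] let [v_k] be the number of vertices seeing [k], [t_k] the
    number of [M]-edges coloured [k], and [r_k] the rank (size of a spanning
    forest) of the set of edges outside [M] coloured [k].  Then
    [10 + 4 r_k + 4 t_k <= 7 v_k]: as [r_k <= v_k - 1], [v_k >= 2] and
    [v_k >= 2 t_k], this is immediate unless [t_k = 1, v_k <= 3] or
    [t_k = 2, v_k = 4], where triangle-freeness lowers [r_k].  Sum over the
    colours: the [v_k] sum to at most [2 |T| = 4 |M|], the [t_k] to [|M|], and
    by subadditivity of the rank the [r_k] sum to at least [2 |M| - h].  The
    result is [10 #colours <= 16 |M| + 4 h]. *)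
Require Import Defs.
From mathcomp Require Import all_boot all_order.
From mathcomp Require Import zify.
Set Implicit Arguments. Unset Strict Implicit. Unset Printing Implicit Defensive.

(** * Rank of a relation, bounded through lists of spanning pairs *)

Section Rank.
Variable T : finType.
Implicit Types (r : rel T) (s : seq (T * T)).

Definition const_on (f : T -> T) s : Prop := forall p, p \in s -> f p.1 = f p.2.

(* Equivalently, every edge of [r] joins two vertices that are connected by
   pairs of [s]; hence the rank of [r] is at most [size s]. *)
Definition spans r s : Prop :=
  forall f, const_on f s -> forall x y, r x y -> f x = f y.

Lemma spans_sub r s1 s2 : {subset s1 <= s2} -> spans r s1 -> spans r s2.
Proof. by move=> s12 sp f fc; apply: sp => p /s12; apply: fc. Qed.

(** Contract the pairs of [s] one at a time: each contraction loses at most one value. *)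
Lemma const_on_quotient s :
  exists2 f, const_on f s & #|T| <= #|codom f| + size s.
Proof.
elim: s => [|[a b] s [f fc le_f]].
  by exists id => //; rewrite addn0 card_codom.
(* Merges the value [f a] into [f b], so only [f a] can leave the image. *)
pose g z := if z == f a then f b else z.
exists (g \o f).
  move=> p; rewrite inE => /predU1P[->|/fc /= -> //].
  by rewrite /g /= eqxx; case: eqP.
apply: leq_trans le_f _; rewrite /= addnS -addSn leq_add2r.
have sub: codom f \subset f a |: [set z in codom (g \o f)].
  apply/subsetP=> _ /codomP[z ->]; rewrite !inE.
  case: eqVneq => //= nz; apply/codomP; exists z.
  by rewrite /= /g (negPf nz).
apply: leq_trans (subset_leq_card sub) _.
rewrite cardsU1 cardsE; exact: leq_add (leq_b1 _) _.
Qed.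

(** Such an [f] is constant along paths, so the component roots already attain all its values. *)
Lemma card_codom_components r (f : T -> T) : symmetric r ->
  (forall x y, r x y -> f x = f y) -> #|codom f| <= num_components r.
Proof.
move=> sym_r fr.
have fpath x p : path r x p -> f x = f (last x p).
  by elim: p x => //= y p IH x /andP[/fr -> /IH].
have froot x : f x = f (root r x).
  by have /connectP[p /fpath fp ->] := connect_root r x.
apply: leq_trans (leq_image_card f _).
apply/subset_leq_card/subsetP=> _ /codomP[x ->].
rewrite froot; apply: image_f; rewrite !inE andbT.
exact: (roots_root (sym_connect_sym sym_r)).
Qed.

Lemma rank_components r s : symmetric r -> spans r s ->
  #|T| <= num_components r + size s.
Proof.
move=> sym_r sp; have [f fc le_f] := const_on_quotient s.
apply: leq_trans le_f _; rewrite leq_add2r.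
exact: card_codom_components sym_r (sp _ fc).
Qed.

(** A star centred at any vertex of [S] spans; for empty [S] the truncated predecessor is 0 and the
    empty list works. *)
Lemma spans_star r (S : {set T}) :
  (forall x y, r x y -> (x \in S) && (y \in S)) ->
  exists2 s, spans r s & size s <= #|S|.-1.
Proof.
move=> rS; have [S0|[a aS]] := set_0Vmem S.
  by exists [::] => // f _ x y /rS; rewrite S0 !inE.
exists [seq (a, x) | x <- enum (S :\ a)].
  move=> f fc; suff fa x : x \in S -> f x = f a.
    by move=> x y /rS/andP[/fa-> /fa->].
  move=> xS; have [->//|xa] := eqVneq x a.
  by rewrite -(fc (a, x)) // map_f // mem_enum !inE xa.
by rewrite size_map -cardE (cardsD1 a S) aS.
Qed.

End Rank.

(** * Colour classes and incidence counts *)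

Section Colouring.
Variables (T : finType) (e : rel T) (M : {set {set T}}) (c : {set T} -> nat).
Hypotheses (e_simple : simple_graph e) (e_tf : triangle_free e).
Hypotheses (M_pm : perfect_matching e M) (c_col : is_edge_2colouring e c).
Implicit Types (f g : {set T}) (k : nat) (u v w x y : T).

Let e_sym : symmetric e := proj1 e_simple.
Let e_irr : irreflexive e := proj2 e_simple.

Definition seeing k : {set T} := [set v | k \in colours_at e c v].
Definition matching_class k : {set {set T}} := [set f in M | c f == k].
Definition rest_class k : rel T :=
  fun x y => remove_edges e M x y && (c [set x; y] == k).

Lemma adj_neq x y : e x y -> x != y.
Proof. by apply: contraTneq => ->; rewrite e_irr. Qed.

Lemma edgeP f :
  reflect (exists x y, e x y /\ f = [set x; y]) (f \in edges e).
Proof.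
apply: (iffP imset2P) => [[x y _ ]|[x [y [exy ->]]]].
  by rewrite inE => /andP[_ exy] ->; exists x, y.
by exists x y => //; rewrite !inE.
Qed.

Lemma mem_seeing f v : f \in edges e -> v \in f -> v \in seeing (c f).
Proof.
move=> fE vf; rewrite inE /colours_at mem_undup map_f //.
by rewrite mem_filter vf mem_enum.
Qed.

Lemma adj_seeing x y :
  e x y -> (x \in seeing (c [set x; y])) && (y \in seeing (c [set x; y])).
Proof.
move=> exy; have fE : [set x; y] \in edges e by apply/edgeP; exists x, y.
by rewrite !mem_seeing // !inE eqxx ?orbT.
Qed.

Lemma rest_seeing k x y :
  rest_class k x y -> (x \in seeing k) && (y \in seeing k).
Proof. by case/andP=> /andP[/adj_seeing + _] /eqP<-. Qed.

Lemma matching_eq f g v : f \in M -> g \in M -> v \in f -> v \in g -> f = g.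
Proof.
move=> fM gM vf vg; have /eqP/cards1P[h Eh] := proj2 M_pm v.
have: f \in [set h] by rewrite -Eh inE fM.
have: g \in [set h] by rewrite -Eh inE gM.
by rewrite !inE => /eqP-> /eqP->.
Qed.

Lemma matching_classE k f : f \in matching_class k ->
  [/\ f \in M, f \subset seeing k & exists x y, e x y /\ f = [set x; y]].
Proof.
rewrite inE => /andP[fM /eqP cf]; have fE := subsetP (proj1 M_pm) f fM.
split=> //; last exact/edgeP.
by apply/subsetP=> v; rewrite -cf; apply: mem_seeing.
Qed.

Lemma card_edge f : f \in edges e -> #|f| = 2.
Proof. by case/edgeP=> x [y [/adj_neq xy ->]]; rewrite cards2 xy. Qed.

Lemma sum_card_incidence (N : {set {set T}}) : N \subset M ->
  2 * #|N| = \sum_v #|[set f in N | v \in f]|.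
Proof.
move=> NM; transitivity (\sum_(f in N) #|f|).
  rewrite mulnC -sum_nat_const; apply: eq_bigr => f fN.
  by rewrite card_edge // (subsetP (proj1 M_pm)) // (subsetP NM).
under [RHS]eq_bigr => v _ do rewrite -sum1dep_card big_mkcondr /=.
rewrite exchange_big /=; apply: eq_bigr => f _.
by rewrite -sum1_card [LHS]big_mkcond.
Qed.

Lemma card_matching : 2 * #|M| = #|T|.
Proof.
rewrite sum_card_incidence // -sum1_card.
by apply: eq_bigr => v _; apply: (proj2 M_pm).
Qed.

(** Double counting: a vertex seeing [k] lies on at most one edge of the class, any other vertex on
    none. *)
Lemma card_matching_class k : 2 * #|matching_class k| <= #|seeing k|.
Proof.
have sub: matching_class k \subset M.
  by apply/subsetP=> f; rewrite inE => /andP[].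
rewrite sum_card_incidence // -sum1_card [leqRHS]big_mkcond.
apply: leq_sum => v _; case: ifPn => [_|nv].
  rewrite -(proj2 M_pm v); apply/subset_leq_card/subsetP=> f.
  by rewrite !inE => /andP[/andP[-> _] ->].
rewrite leqn0 cards_eq0; apply/eqP/setP=> f; rewrite [RHS]inE; apply/negbTE.
apply: contra nv; rewrite inE => /andP[/matching_classE[_ /subsetP sf _]].
exact: sf.
Qed.

(** * Rank of a single colour class outside [M] *)

Lemma rest_classN k x y f : f \in M -> f = [set x; y] -> ~~ rest_class k x y.
Proof. by move=> fM Ef; rewrite /rest_class /remove_edges -Ef fM andbF. Qed.

Lemma rest_sym k : symmetric (rest_class k).
Proof.
by move=> x y; rewrite /rest_class /remove_edges e_sym setUC.
Qed.

Lemma rest_adj k x y : rest_class k x y -> e x y.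
Proof. by case/andP=> /andP[]. Qed.

Lemma rest_irr k x : rest_class k x x = false.
Proof. by apply/negP=> /rest_adj; rewrite e_irr. Qed.

(** Saves one over [spans_star]: two seeing vertices carry only the matching edge, and with a third
    vertex two further edges would close a triangle. *)
Lemma rank_one_matching k : #|matching_class k| = 1 -> #|seeing k| <= 3 ->
  exists2 s, spans (rest_class k) s & size s + 2 <= #|seeing k|.
Proof.
move=> /eqP/cards1P[f Ef] V3.
have [|fM fV [u [v [euv Ef']]]] := @matching_classE k f.
  by rewrite Ef inE.
have uv := adj_neq euv.
have nruv := rest_classN k fM Ef'.
have nrvu : ~~ rest_class k v u by rewrite rest_sym.
have cf : #|f| = 2 by rewrite Ef' cards2 uv.
have cD : #|seeing k :\: f| = #|seeing k| - 2.
  by rewrite cardsD (setIidPr fV) cf.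
have le2 : 2 <= #|seeing k| by rewrite -cf subset_leq_card.
have VE x : (x \in seeing k) = [|| x == u, x == v | x \in seeing k :\: f].
  rewrite [x \in _ :\: _]inE.
  have : x \in f -> x \in seeing k by apply/subsetP.
  rewrite Ef' !inE; case: (x == u); case: (x == v) => //=; exact.
have [V2|V2] := leqP #|seeing k| 2.
  exists [::] => // g _ x y rxy; have /andP[] := rest_seeing rxy.
  have /eqP D0: #|seeing k :\: f| == 0 by rewrite cD; lia.
  rewrite !VE (cards0_eq D0) !inE !orbF.
  move=> /orP[]/eqP Ex /orP[]/eqP Ey; move: rxy; rewrite {}Ex {}Ey //.
  - by rewrite (negPf nruv).
  - by rewrite (negPf nrvu).
have /cards1P[w Dw]: #|seeing k :\: f| == 1 by rewrite cD; lia.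
(* [w] is adjacent to at most one end of the matching edge, so the other end
   is isolated. *)
have [a ra]: exists a, forall x y, rest_class k x y ->
    (x \in [set a; w]) && (y \in [set a; w]).
  have key x y : rest_class k x y ->
      [|| (x == w) && (y != w) | (y == w) && (x != w)].
    move=> rxy; have /andP[] := rest_seeing rxy.
    rewrite !VE Dw !inE; have := adj_neq (rest_adj rxy).
    case: (eqVneq x w) => [->|_]; case: (eqVneq y w) => [->|_] //=.
    rewrite !orbF => _ /orP[]/eqP Ex /orP[]/eqP Ey; move: rxy;
      by rewrite Ex Ey ?rest_irr ?(negPf nruv) ?(negPf nrvu).
  exists (if e u w then u else v).
  suff half x : rest_class k x w -> x = if e u w then u else v.
    move=> x y rxy; have /orP[] := key _ _ rxy => /andP[/eqP E _];
      move: rxy; rewrite {}E ?[_ _ w _]rest_sym => /half->;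
      by rewrite !inE !eqxx ?orbT.
  move=> rxw; have /andP[+ _] := rest_seeing rxw.
  have xw := adj_neq (rest_adj rxw).
  rewrite VE Dw !inE (negPf xw) orbF; have exw := rest_adj rxw.
  case: ifPn => [euw|neuw] /orP[]/eqP Ex //; move: exw; rewrite Ex => exw.
    by have := e_tf u v w; rewrite euv exw e_sym euw.
  by rewrite exw in neuw.
have [s sp le_s] := spans_star ra; exists s => //.
by move: le_s; rewrite cards2; case: (_ != _) => /=; lia.
Qed.

(** The four vertices are the ends of the two matching edges, and no vertex is adjacent to both ends
    of the opposite edge. *)
Lemma rank_two_matching k : #|matching_class k| = 2 -> #|seeing k| = 4 ->
  exists2 s, spans (rest_class k) s & size s <= 2.
Proof.
move=> /eqP/cards2P[f [g [fg Efg]]] V4.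
have [|fM fV [a [b [eab Ef]]]] := @matching_classE k f.
  by rewrite Efg !inE eqxx.
have [|gM gV [x [y [exy Eg]]]] := @matching_classE k g.
  by rewrite Efg !inE eqxx orbT.
have nab := rest_classN k fM Ef.
have nxy := rest_classN k gM Eg.
have VE : seeing k = f :|: g.
  apply/esym/eqP; rewrite eqEcard subUset fV gV /= V4 cardsU.
  have -> : f :&: g = set0.
    apply/setP=> z; rewrite !inE; apply/negbTE/negP=> /andP[zf zg].
    by rewrite (matching_eq fM gM zf zg) eqxx in fg.
  by rewrite cards0 Ef Eg !cards2 (adj_neq eab) (adj_neq exy).
(* Up to exchanging [x] and [y], the edges outside [M] are among [ax], [by]. *)
wlog nn : x y exy Eg nxy / ~~ e a y /\ ~~ e b x => [wl|].
  (* Either of [ax], [by] excludes [ay] and [bx], which would close triangles; if both are absent,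
     exchange [x] and [y]. *)
  have [h|h] := boolP (e a x || e b y).
    apply: (wl x y) => //; split; apply/negP=> h'.
      case/orP: h => h''.
        by have := e_tf a x y; rewrite h'' exy e_sym h'.
      by have := e_tf a b y; rewrite eab h'' e_sym h'.
    case/orP: h => h''.
      by have := e_tf a b x; rewrite eab h' e_sym h''.
    by have := e_tf b x y; rewrite h' exy e_sym h''.
  move: h; rewrite negb_or => /andP[nax nby].
  by apply: (wl y x) => //; rewrite 1?e_sym 1?setUC 1?rest_sym.
case: nn => nay nbx.
exists [:: (a, x); (b, y)] => // h hc.
have hax : h a = h x by apply: (hc (a, x)); rewrite !inE eqxx.
have hby : h b = h y by apply: (hc (b, y)); rewrite !inE eqxx orbT.
have nbx' : ~~ rest_class k b x by apply: contra nbx; apply: rest_adj.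
have nay' : ~~ rest_class k a y by apply: contra nay; apply: rest_adj.
move=> z t rzt; have /andP[] := rest_seeing rzt.
rewrite VE Ef Eg !inE -!orbA.
by move=> /or4P[]/eqP Ez /or4P[]/eqP Et; move: rzt; rewrite {}Ez {}Et //;
  rewrite ?rest_irr // 1?rest_sym ?(negPf nab) ?(negPf nxy) ?(negPf nbx')
  ?(negPf nay') // 1?rest_sym ?(negPf nab) ?(negPf nxy) ?(negPf nbx')
  ?(negPf nay').
Qed.

Lemma colour_bound k : k \in [seq c f | f <- enum (edges e)] ->
  exists2 s, spans (rest_class k) s &
    10 + 4 * size s + 4 * #|matching_class k| <= 7 * #|seeing k|.
Proof.
case/mapP=> f; rewrite mem_enum => fE ck.
have v2 : 2 <= #|seeing k|.
  rewrite -(card_edge fE); apply/subset_leq_card/subsetP=> v.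
  by rewrite ck; apply: mem_seeing.
have tv := card_matching_class k.
have [s sp le_s] := spans_star (@rest_seeing k).
(* This is the claim for a star, with rank at most [#|seeing k| - 1]. Its failure, with [v2] and
   [tv], leaves only the two special cases. *)
have [big|small] := leqP (6 + 4 * #|matching_class k|) (3 * #|seeing k|).
  by exists s => //; lia.
have [t1|t1] := eqVneq #|matching_class k| 1.
  have [|s' sp' le_s'] := rank_one_matching t1; first by lia.
  by exists s' => //; lia.
have [t2|t2] := eqVneq #|matching_class k| 2; last by lia.
have [|s' sp' le_s'] := rank_two_matching t2; first by lia.
by exists s' => //; lia.
Qed.

(** * Summation over the colours *)

Lemma sum_seeing (ks : seq nat) : uniq ks ->
  \sum_(k <- ks) #|seeing k| <= 2 * #|T|.
Proof.
move=> uks.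
under eq_bigr => k _ do rewrite -sum1dep_card big_mkcond /=.
rewrite exchange_big /= mulnC -sum_nat_const; apply: leq_sum => v _.
apply: leq_trans (c_col v); rewrite -big_mkcond sum1_count -size_filter.
apply: uniq_leq_size; first exact: filter_uniq.
by move=> k; rewrite mem_filter => /andP[].
Qed.

Lemma sum_matching_class (ks : seq nat) : uniq ks ->
  (forall f, f \in M -> c f \in ks) ->
  \sum_(k <- ks) #|matching_class k| = #|M|.
Proof.
move=> uks cks.
under eq_bigr => k _ do rewrite -sum1dep_card big_mkcondr /=.
rewrite exchange_big /= -sum1_card; apply: eq_bigr => f fM.
rewrite -big_mkcond sum1_count (@eq_count _ _ (pred1 (c f))) => [|k /=].
  by rewrite count_uniq_mem // cks.
by rewrite eq_sym.
Qed.

(** Subadditivity of rank: the concatenated lists of the colours span every class. *)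
Lemma sum_colour_bound (ks : seq nat) :
  {subset ks <= [seq c f | f <- enum (edges e)]} ->
  exists2 s, (forall k, k \in ks -> spans (rest_class k) s) &
    10 * size ks + 4 * size s + 4 * \sum_(k <- ks) #|matching_class k|
      <= 7 * \sum_(k <- ks) #|seeing k|.
Proof.
elim: ks => [|k ks IH] sub; first by exists [::]; rewrite ?big_nil.
have [|s sp le_s] := IH _; first by move=> l lks; apply: sub; rewrite inE lks orbT.
have [|s' sp' le_s'] := @colour_bound k; first by apply: sub; rewrite mem_head.
exists (s' ++ s); last first.
  rewrite !big_cons size_cat [size (k :: ks)]/=.
  move: le_s le_s'; set A := \sum_(_ <- _) _; set B := \sum_(_ <- _) _.
  lia.
move=> l; rewrite inE => /predU1P[->|/sp].
  by apply: spans_sub sp' => p; rewrite mem_cat => ->.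
by apply: spans_sub => p; rewrite mem_cat => ->; rewrite orbT.
Qed.

Lemma num_colours_bound :
  10 * num_colours e c <= 16 * #|M| + 4 * num_components (remove_edges e M).
Proof.
rewrite /num_colours; set ks := undup _.
have uks : uniq ks by apply: undup_uniq.
have ksE f : f \in edges e -> c f \in ks.
  by move=> fE; rewrite mem_undup map_f // mem_enum.
have [|s sp le_s] := @sum_colour_bound ks; first by move=> k; rewrite mem_undup.
have symH : symmetric (remove_edges e M).
  by move=> x y; rewrite /remove_edges e_sym setUC.
(* Each edge outside [M] lies in the class of its own colour. *)
have spH : spans (remove_edges e M) s.
  move=> f fc x y rxy; apply: (sp (c [set x; y])) => //.
    by apply: ksE; apply/edgeP; exists x, y; case/andP: rxy.
  by rewrite /rest_class rxy eqxx.
have := rank_components symH spH; have := sum_seeing uks.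
have Mks f : f \in M -> c f \in ks by move/(subsetP (proj1 M_pm))/ksE.
rewrite (sum_matching_class uks Mks) in le_s.
rewrite -card_matching; move: le_s.
move: (size ks) (size s) #|M| (num_components _) (\sum_(_ <- _) _) => *.
lia.
Qed.

End Colouring.

(* OPT <= 8/5 (|M| + h) is stated as: every edge 2-colouring c uses at most
   that many colours, written over nat as 5 * #colours <= 8 * (|M| + h). *)
Theorem theorem1 (T : finType) (e : rel T) (M : {set {set T}}) :
  simple_graph e -> triangle_free e -> perfect_matching e M ->
  forall c : {set T} -> nat, is_edge_2colouring e c ->
  5 * num_colours e c <= 8 * (#|M| + num_components (remove_edges e M)).
Proof.
move=> e_simple e_tf M_pm c c_col.
(* Halving gives coefficient 2 for the components, stronger than the required 8. *)
have := num_colours_bound e_simple e_tf M_pm c_col; lia.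
Qed.
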